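(* Let $R$ be a finite commutative ring, $V$ a finite $R$-module and $e\in E(R)$. Let $\mathcal O_1,\ldots,\mathcal O_s$ be the orbits of $U(Re)$ on $e\widehat V$ (identified with $\widehat{eV}$) and let $\chi_i\in\mathcal O_i$. Then the composition factors of the $\mathbb C\mathrm{Aff}(V)$-module $\mathbb CV$ with apex $g_e$ (where $g_e(x)=ex$) are exactly the modules $W^\sharp_{(\mathcal O_i,\mathbf 1_{\mathrm{St}_{U(Re)}(\chi_i)})}$ with \[\mathcal O_i\subseteq e\widehat V\setminus\bigcup_{f\in E(R),\ Rf\subsetneq Re}f\widehat V,\] and each of them appears with multiplicity one.
   Context: $E(R)$: idempotents of $R$; $U(\cdot)$: unit group; $Re$ is a unital ring with identity $e$ and $eV$ an $Re$-module. $\mathrm{Aff}(M)$ (for a module $M$ over a commutative ring $S$) is the monoid of maps $x\mapsto ax+b$ ($a\in S$, $b\in M$) under composition; $\mathbb C\mathrm{Aff}(V)$ is its monoid algebra, and $\mathbb CV$ is the module with basis $V$ on which $ax+b$ acts by $v\mapsto av+b$. $\widehat V$ is the character group of $(V,+)$, an $R$-module via $(r\chi)(v)=\chi(rv)$; $e\widehat V=\{\chi\in\widehat V: e\chi=\chi\}$, identified with $\widehat{eV}$ via restriction to $eV$. $\mathrm{St}_{U(Re)}(\chi)=\{u\in U(Re): u\chi=\chi\}$. With $U(\mathrm{Aff}(eV))=eV\rtimes U(Re)$ (translations and dilations), for an orbit $\mathcal O\ni\chi$ of $U(Re)$ on $\widehat{eV}$ and a character $\rho$ of $\mathrm{St}_{U(Re)}(\chi)$,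 let $W_{(\mathcal O,\rho)}=\mathrm{Ind}^{U(\mathrm{Aff}(eV))}_{eV\rtimes\mathrm{St}_{U(Re)}(\chi)}\chi\otimes\rho$, where $(\chi\otimes\rho)(ax+b)=\chi(b)\rho(a)$. $W^\sharp_{(\mathcal O,\rho)}$ is the vector space $W_{(\mathcal O,\rho)}$ made into a $\mathbb C\mathrm{Aff}(V)$-module by $(ax+b)w=(aex+eb)w$ if $Ra\supseteq Re$ and $(ax+b)w=0$ otherwise; it is simple. An idempotent $g$ of a monoid $M$ is an apex of a simple module $S'$ if $gS'\neq0$ and $mS'=0$ for all $m\in M$ with $g\notin MmM$. $\mathbf 1_G$ is the trivial character.
   Formalization: Elements of Aff(V) are taken as formal pairs (a,b) composed like the maps x ↦ ax+b; for faithful V this is the monoid of maps, while for non-faithful V the literal statement fails (R=F2×F2, V=F2×0, e=(1,1)) and W^♯ is not well defined on maps. *)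

(* Defs.v *)
From HB Require Import structures.
From mathcomp Require Import all_boot all_order fingroup all_algebra.
From mathcomp Require Import classical_sets reals complex.

Set Implicit Arguments.
Unset Strict Implicit.
Unset Printing Implicit Defensive.

Import GRing.Theory.
Local Open Scope ring_scope.

(* Finite modules. MathComp's finLmodType requires a nonzero ring of scalars,
   which would exclude the ring Re for e = 0. *)
Record finmod (R : pzRingType) := FinMod {
  fm_lmod : lmodType R;
  fm_enum : seq fm_lmod;
  fm_enumP : Finite.axiom fm_enum
}.

Definition fm_sort (R : pzRingType) (V : finmod R) : Type := fm_lmod V.
Coercion fm_sort : finmod >-> Sortclass.

Section FinMod.
Variables (R : pzRingType) (V : finmod R).

HB.instance Definition _ := GRing.Lmodule.copy (fm_sort V) (fm_lmod V).

Lemma fm_indexK :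
  cancel (fun v : fm_sort V => index v (fm_enum V)) (nth 0 (fm_enum V)).
Proof.
move=> v; apply: nth_index; rewrite -has_pred1 has_count.
by have /= -> := fm_enumP v.
Qed.

HB.instance Definition _ := CanIsCountable fm_indexK.
HB.instance Definition _ := isFinite.Build (fm_sort V) (@fm_enumP R V).
End FinMod.

(* A finite-dimensional CM-module is a C-vector space with a linear action
   of the monoid M. *)
Record cmod (C : fieldType) (M : monoidType) := CMod {
  carrier :> vectType C;
  act : M -> 'End(carrier);
  act1 : act 1%g = \1%VF;
  actM : forall m n, act (m * n)%g = (act m \o act n)%VF
}.

Record submodule (C : fieldType) (M : monoidType) (X : cmod C M) := Submodule {
  subsp :> {vspace X};
  sub_stable : forall m, (act X m @: subsp <= subsp)%VS
}.

Section ModuleTheory.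
Variables (C : fieldType) (M : monoidType).
Implicit Types (X Y : cmod C M).

Definition simple X : Prop :=
  {:X}%VS <> 0%VS /\ forall U : submodule X, U = 0%VS :> {vspace X} \/
                                             U = {:X}%VS :> {vspace X}.

Definition iso X Y : Prop :=
  exists f : 'Hom(X, Y),
    [/\ lker f = 0%VS, limg f = {:Y}%VS
      & forall m, (f \o act X m)%VF = (act Y m \o f)%VF].

Definition apex (g : M) X : Prop :=
  [/\ (g * g)%g = g, act X g <> 0
    & forall m, ~ (exists x y, g = (x * m * y)%g) -> act X m = 0].

Section Restriction.
Variables (X : cmod C M) (U : submodule X).

Definition sub_act m : 'End(subvs_of U) :=
  (linfun (vsproj U) \o act X m \o linfun vsval)%VF.

Lemma val_sub_act m (w : subvs_of U) : vsval (sub_act m w) = act X m (vsval w).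
Proof.
rewrite /sub_act !comp_lfunE !lfunE /= vsprojK //.
by apply: (subvP (sub_stable U m)); apply: memv_img; apply: subvsP.
Qed.

Lemma sub_act1 : sub_act 1%g = \1%VF.
Proof. by apply/lfunP=> w; apply: subvs_inj; rewrite val_sub_act act1 !lfunE. Qed.

Lemma sub_actM m n : sub_act (m * n)%g = (sub_act m \o sub_act n)%VF.
Proof.
apply/lfunP=> w; apply: subvs_inj.
by rewrite (comp_lfunE (sub_act m)) !val_sub_act actM comp_lfunE.
Qed.

Definition submod : cmod C M := CMod sub_act1 sub_actM.
End Restriction.

Section Quotient.
Variables (X : cmod C M) (U : submodule X).

(* The quotient X / U is realised on a complement of U; quot_pi is the
   canonical surjection, with kernel U. *)
Definition quot_pi : 'Hom(X, subvs_of (U^C)%VS) :=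
  (linfun (vsproj U^C) \o daddv_pi U^C U)%VF.

Lemma capCv : (U^C :&: U = 0)%VS.
Proof. by rewrite capvC capv_compl. Qed.

Lemma val_quot_pi w : vsval (quot_pi w) = daddv_pi U^C U w.
Proof. by rewrite /quot_pi comp_lfunE lfunE /= vsprojK ?memv_pi. Qed.

Lemma quot_piK : cancel vsval quot_pi.
Proof.
move=> w; apply: subvs_inj; rewrite val_quot_pi /=.
by rewrite daddv_pi_id ?capCv ?subvsP.
Qed.

Lemma quot_pi_sub w : w - vsval (quot_pi w) \in U.
Proof.
rewrite val_quot_pi -[X in X - _](@daddv_pi_add _ _ _ _ w capCv).
  by rewrite addrAC subrr add0r memv_pi.
by rewrite addvC addv_complf memvf.
Qed.

Lemma lker_quot_pi : lker quot_pi = U.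
Proof.
apply/vspaceP=> w; rewrite memv_ker; apply/eqP/idP=> [w0 | Uw].
  by have:= quot_pi_sub w; rewrite w0 (raddf0 vsval) subr0.
have UCw: vsval (quot_pi w) \in (U^C :&: U)%VS.
  rewrite memv_cap subvsP; have := memvB Uw (quot_pi_sub w).
  by rewrite subKr.
by move: UCw; rewrite capCv memv0 => /eqP w0; apply: subvs_inj; rewrite w0.
Qed.

Lemma limg_quot_pi : limg quot_pi = fullv.
Proof.
apply/vspaceP=> w; rewrite memvf; apply/memv_imgP.
by exists (vsval w); rewrite ?memvf ?quot_piK.
Qed.

Definition quot_act m : 'End(subvs_of (U^C)%VS) :=
  (quot_pi \o act X m \o linfun vsval)%VF.

Lemma quot_act_pi m w : quot_act m (quot_pi w) = quot_pi (act X m w).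
Proof.
rewrite /quot_act (comp_lfunE (_ \o _)%VF) (comp_lfunE quot_pi) (lfunE vsval).
apply/eqP.
rewrite -subr_eq0 -(linearB quot_pi) -memv_ker lker_quot_pi -linearB.
apply: (subvP (sub_stable U m)); apply: memv_img.
by rewrite -opprB memvN quot_pi_sub.
Qed.

Lemma quot_act1 : quot_act 1%g = \1%VF.
Proof.
by apply/lfunP=> w; rewrite -[w]quot_piK quot_act_pi act1 !lfunE.
Qed.

Lemma quot_actM m n : quot_act (m * n)%g = (quot_act m \o quot_act n)%VF.
Proof.
apply/lfunP=> w; rewrite -[w]quot_piK (comp_lfunE (quot_act m)).
by rewrite !quot_act_pi actM comp_lfunE.
Qed.

Definition quotmod : cmod C M := CMod quot_act1 quot_actM.
End Quotient.

Section Factor.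
Variables (X : cmod C M) (A B : submodule X).

Definition trace_vs : {vspace submod A} := (linfun vsval @^-1: B)%VS.

Lemma trace_stable m : (act (submod A) m @: trace_vs <= trace_vs)%VS.
Proof.
apply/subvP=> _ /memv_imgP[w Bw ->].
move: Bw; rewrite -!memv_preim !(lfunE vsval) => Bw.
rewrite [X in X \in _](val_sub_act m w).
by apply: (subvP (sub_stable B m)); apply: memv_img.
Qed.

(* A / B, meaningful when B <= A. *)
Definition subquot : cmod C M := quotmod (Submodule trace_stable).
End Factor.

Definition composition_series X n (U : nat -> submodule X) : Prop :=
  [/\ U 0%N = 0%VS :> {vspace X}, U n = {:X}%VS :> {vspace X}
    & forall i, (i < n)%N -> (U i <= U i.+1)%VS /\ simple (subquot (U i.+1) (U i))].

(* The module with basis (delta x) indexed by a finite M-set T. *)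
Section Linearization.
Variables (T : finType) (op : M -> T -> T).
Hypotheses (op1 : op 1%g =1 id) (opM : forall m n, op (m * n)%g =1 op m \o op n).

Definition lin_act_fun m (f : {ffun T -> C^o}) : {ffun T -> C^o} :=
  [ffun y => \sum_(x | op m x == y) f x].

Lemma lin_act_linear m : linear (lin_act_fun m).
Proof.
move=> a f g; apply/ffunP=> y; rewrite !ffunE scaler_sumr -big_split.
by apply: eq_bigr => x _; rewrite !ffunE.
Qed.

HB.instance Definition _ m := GRing.isLinear.Build C {ffun T -> C^o}
  {ffun T -> C^o} *:%R (lin_act_fun m) (lin_act_linear m).

Definition lin_act m : 'End({ffun T -> C^o}) := linfun (lin_act_fun m).

Definition delta (x : T) : {ffun T -> C^o} := [ffun y => (x == y)%:R].

Lemma lin_act_delta m x : lin_act m (delta x) = delta (op m x).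
Proof.
rewrite lfunE; apply/ffunP=> y; rewrite !ffunE big_mkcond (bigD1 x) //= !ffunE eqxx.
rewrite big1 ?addr0 => [|z]; first by case: eqP.
by rewrite ffunE eq_sym => /negPf->; case: eqP.
Qed.

Lemma lin_act1 : lin_act 1%g = \1%VF.
Proof.
apply/lfunP=> f; rewrite !lfunE; apply/ffunP=> y.
by rewrite ffunE (big_pred1 y) // => x; rewrite op1.
Qed.

Lemma lin_actM m n : lin_act (m * n)%g = (lin_act m \o lin_act n)%VF.
Proof.
apply/lfunP=> f; rewrite comp_lfunE !lfunE; apply/ffunP=> y; rewrite !ffunE.
rewrite (partition_big (op n) (fun z => op m z == y)) /= => [|x]; last by rewrite opM.
apply: eq_bigr => z mz; rewrite ffunE; apply: eq_bigl => x.
by rewrite opM /=; case: (op n x =P z) => [->|]; rewrite ?mz ?andbF.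
Qed.

Definition linmod : cmod C M := CMod lin_act1 lin_actM.
End Linearization.
End ModuleTheory.

Section Induction.
Variables (C : fieldType) (G : finGroupType) (H : {set G}) (lam : G -> C).

Definition regmod : cmod C G :=
  linmod C (op := fun g h : G => (g * h)%g) (@mul1g G) (fun g h k => esym (mulgA g h k)).

Definition ind_rel : seq regmod :=
  [seq delta C (gh.1 * gh.2)%g - lam gh.2 *: delta C gh.1
     | gh in [pred gh : G * G | gh.2 \in H]].

Lemma ind_rel_stable g : (act regmod g @: <<ind_rel>> <= <<ind_rel>>)%VS.
Proof.
rewrite limg_span; apply/span_subvP=> v /mapP[w].
rewrite /ind_rel; case/fintype.imageP=> -[x h] /= Hh -> ->.
rewrite linearB linearZ /= !lin_act_delta mulgA.
by apply/memv_span/fintype.imageP; exists (g * x, h)%g.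
Qed.

(* Ind_H^G lam = CG (x)_(CH) lam for a linear character lam of the subgroup H,
   presented as the quotient of CG by the relations gh = lam(h) g. *)
Definition induced : cmod C G := quotmod (Submodule ind_rel_stable).
End Induction.

(* Aff a b stands for the map x |-> a x + b; it is kept as the formal pair
   (a, b), since distinct a may act in the same way on a non-faithful V. *)
Record aff (R : pzRingType) (V : lmodType R) := Aff { slope : R; shift : V }.

Section Affine.
Variables (R : finComPzRingType) (V : finmod R).

Definition aff_pair (m : aff V) := (slope m, shift m).
Definition pair_aff (p : R * V) : aff V := Aff p.1 p.2.
Lemma aff_pairK : cancel aff_pair pair_aff. Proof. by case. Qed.
HB.instance Definition _ := Finite.copy (aff V) (can_type aff_pairK).

Definition aff_eval (m : aff V) (v : V) : V := slope m *: v + shift m.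
Definition aff_one : aff V := Aff 1 0.
Definition aff_mul (m n : aff V) : aff V :=
  Aff (slope m * slope n) (slope m *: shift n + shift m).

Lemma aff_mulA : associative aff_mul.
Proof.
by move=> m n p; congr Aff; rewrite /= ?mulrA // scalerDr scalerA addrA.
Qed.
Lemma aff_mul1 : left_id aff_one aff_mul.
Proof. by case=> a b; congr Aff; rewrite /= ?mul1r // scale1r addr0. Qed.
Lemma aff_mulr1 : right_id aff_one aff_mul.
Proof. by case=> a b; congr Aff; rewrite /= ?mulr1 // scaler0 add0r. Qed.

HB.instance Definition _ := isMonoid.Build (aff V) aff_mulA aff_mul1 aff_mulr1.

Lemma aff_eval1 : aff_eval 1%g =1 id.
Proof. by move=> v; rewrite /aff_eval /= scale1r addr0. Qed.
Lemma aff_evalM (m n : aff V) : aff_eval (m * n)%g =1 aff_eval m \o aff_eval n.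
Proof. by move=> v; rewrite /aff_eval /= scalerDr scalerA addrA. Qed.

(* CV: ax + b sends the basis vector v to av + b, see lin_act_delta. *)
Definition freemod (C : fieldType) : cmod C (aff V) := linmod C aff_eval1 aff_evalM.
End Affine.

Section Units.
Variables (R : finComPzRingType) (V : finmod R).
Local Notation M := (aff V).

Definition munit (x : M) := [exists y, (x * y == 1)%g && (y * x == 1)%g].

Record units := Unit { uval : M; uvalP : munit uval }.
HB.instance Definition _ := [isSub for uval].
HB.instance Definition _ := [Finite of units by <:].

Lemma munit1 : munit 1%g.
Proof. by apply/existsP; exists 1%g; rewrite mulg1 eqxx. Qed.

Lemma munitM x y : munit x -> munit y -> munit (x * y)%g.
Proof.
case/existsP=> x' /andP[/eqP xx' /eqP x'x] /existsP[y' /andP[/eqP yy' /eqP y'y]].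
apply/existsP; exists (y' * x')%g; rewrite -!mulgA.
by rewrite (mulgA y) yy' mul1g xx' (mulgA x') x'x mul1g y'y eqxx.
Qed.

Lemma munit_inv x : exists2 y, munit y & munit x -> (x * y = 1)%g /\ (y * x = 1)%g.
Proof.
have [/existsP[y /andP[xy yx]]|nx] := boolP (munit x); last by exists 1%g; rewrite ?munit1.
exists y; last by rewrite (eqP xy) (eqP yx).
by apply/existsP; exists x; rewrite xy yx.
Qed.

Definition unit_one := Unit munit1.
Definition unit_mul (x y : units) := Unit (munitM (uvalP x) (uvalP y)).
Definition unit_inv (x : units) : units :=
  odflt unit_one [pick y | uval x * uval y == 1]%g.

Lemma unit_mulA : associative unit_mul.
Proof. by move=> x y z; apply: val_inj; rewrite /= mulgA. Qed.
Lemma unit_mul1 : left_id unit_one unit_mul.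
Proof. by move=> x; apply: val_inj; rewrite /= mul1g. Qed.
Lemma unit_mulr1 : right_id unit_one unit_mul.
Proof. by move=> x; apply: val_inj; rewrite /= mulg1. Qed.
Lemma unit_mulrV : right_inverse unit_one unit_inv unit_mul.
Proof.
move=> x; apply: val_inj; rewrite /= /unit_inv; case: pickP => [y /eqP //|nx].
have [y uy xy] := munit_inv (uval x).
by have := nx (Unit uy); rewrite /= (xy (uvalP x)).1 eqxx.
Qed.
Lemma unit_mulV : left_inverse unit_one unit_inv unit_mul.
Proof.
move=> x; have := unit_mulrV (unit_inv x); set y := unit_inv x => yy'.
suff xE : x = unit_inv y by rewrite [in unit_mul y x]xE.
by rewrite -[LHS]unit_mulr1 -yy' unit_mulA unit_mulrV unit_mul1.
Qed.

HB.instance Definition _ := isGroup.Build units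
  unit_mulA unit_mul1 unit_mulr1 unit_mulV unit_mulrV.
End Units.

Section Dual.
Variables (C : fieldType) (V : finZmodType).

Definition is_char (f : {ffun V -> C}) :=
  (f 0 == 1) && [forall v, forall w, f (v + w) == f v * f w].

Record dual := Dual { dual_val :> {ffun V -> C}; dualP : is_char dual_val }.
HB.instance Definition _ := [isSub for dual_val].
HB.instance Definition _ := [Choice of dual by <:].
End Dual.

Lemma is_char_comp (C : fieldType) (V W : finZmodType) (f : {additive V -> W})
  (chi : dual C W) : is_char [ffun v => chi (f v)].
Proof.
have /andP[/eqP chi0 /forallP chiD] := dualP chi.
apply/andP; split; first by rewrite ffunE raddf0 chi0.
by apply/forallP=> v; apply/forallP=> w; rewrite !ffunE raddfD (eqP (forallP (chiD _) _)).
Qed.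

Definition dact (C : fieldType) (R : finComPzRingType) (V : finmod R) (r : R)
    (chi : dual C V) : dual C V :=
  Dual (is_char_comp ( *:%R r : {additive V -> V}) chi).

Record idem (R : finComPzRingType) := Idem { ival :> R; idemP : ival * ival = ival }.

Definition pideal (R : finComPzRingType) (a : R) : {set R} := [set r * a | r : R].

Section Corner.
Variables (R : finComPzRingType) (e : idem R).

Record corner := Corner { cval : R; cvalP : cval \in pideal e }.
HB.instance Definition _ := [isSub for cval].
HB.instance Definition _ := [Finite of corner by <:].

Lemma pidealE (x : R) : (x \in pideal e) = (x * ival e == x).
Proof.
apply/imsetP/eqP=> [[r _ ->] | xe]; first by rewrite -mulrA idemP.
by exists x.
Qed.

Lemma corner_memM x y : y \in pideal e -> x * y \in pideal e.
Proof. by rewrite !pidealE -mulrA => /eqP->. Qed.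
Lemma corner_mem0 : 0 \in pideal e. Proof. by rewrite pidealE mul0r. Qed.
Lemma corner_mem1 : ival e \in pideal e. Proof. by rewrite pidealE idemP. Qed.
Lemma corner_memD x y : x \in pideal e -> y \in pideal e -> x + y \in pideal e.
Proof. by rewrite !pidealE mulrDl => /eqP-> /eqP->. Qed.
Lemma corner_memN x : x \in pideal e -> - x \in pideal e.
Proof. by rewrite !pidealE mulNr eqr_opp. Qed.

Definition c_zero := Corner corner_mem0.
Definition c_one := Corner corner_mem1.
Definition c_add (x y : corner) := Corner (corner_memD (cvalP x) (cvalP y)).
Definition c_opp (x : corner) := Corner (corner_memN (cvalP x)).
Definition c_mul (x y : corner) := Corner (corner_memM (cval x) (cvalP y)).

Lemma c_addA : associative c_add.
Proof. by move=> x y z; apply: val_inj; rewrite /= addrA. Qed.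
Lemma c_addC : commutative c_add.
Proof. by move=> x y; apply: val_inj; rewrite /= addrC. Qed.
Lemma c_add0 : left_id c_zero c_add.
Proof. by move=> x; apply: val_inj; rewrite /= add0r. Qed.
Lemma c_addN : left_inverse c_zero c_opp c_add.
Proof. by move=> x; apply: val_inj; rewrite /= addNr. Qed.
Lemma c_mulA : associative c_mul.
Proof. by move=> x y z; apply: val_inj; rewrite /= mulrA. Qed.
Lemma c_mulC : commutative c_mul.
Proof. by move=> x y; apply: val_inj; rewrite /= mulrC. Qed.
Lemma c_mul1 : left_id c_one c_mul.
Proof.
move=> x; apply: val_inj; rewrite /= mulrC.
by have := cvalP x; rewrite pidealE => /eqP.
Qed.
Lemma c_mulDl : left_distributive c_mul c_add.
Proof. by move=> x y z; apply: val_inj; rewrite /= mulrDl. Qed.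

HB.instance Definition _ := GRing.isZmodule.Build corner c_addA c_addC c_add0 c_addN.
HB.instance Definition _ := GRing.Zmodule_isComPzRing.Build corner
  c_mulA c_mulC c_mul1 c_mulDl.

Variable V : finmod R.

Record cornerV := CornerV { vval : V; vvalP : vval \in [set ival e *: v | v : V] }.
HB.instance Definition _ := [isSub for vval].
HB.instance Definition _ := [Finite of cornerV by <:].

Lemma eVE (v : V) : (v \in [set ival e *: w | w : V]) = (ival e *: v == v).
Proof.
apply/imsetP/eqP=> [[w _ ->] | ev]; first by rewrite scalerA idemP.
by exists v.
Qed.

Lemma eV_memZ (v : V) : ival e *: v \in [set ival e *: w | w : V].
Proof. exact: imset_f. Qed.
Lemma eV_mem0 : 0 \in [set ival e *: w | w : V].
Proof. by rewrite eVE scaler0. Qed.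
Lemma eV_memD (v w : V) : v \in [set ival e *: w | w : V] ->
  w \in [set ival e *: w | w : V] -> v + w \in [set ival e *: w | w : V].
Proof. by rewrite !eVE scalerDr => /eqP-> /eqP->. Qed.
Lemma eV_memN (v : V) : v \in [set ival e *: w | w : V] ->
  - v \in [set ival e *: w | w : V].
Proof. by rewrite !eVE scalerN eqr_opp. Qed.
Lemma eV_memS (r : R) (v : V) : v \in [set ival e *: w | w : V] ->
  r *: v \in [set ival e *: w | w : V].
Proof. by rewrite !eVE scalerA mulrC -scalerA => /eqP->. Qed.

Definition v_zero := CornerV eV_mem0.
Definition v_add (x y : cornerV) := CornerV (eV_memD (vvalP x) (vvalP y)).
Definition v_opp (x : cornerV) := CornerV (eV_memN (vvalP x)).
Definition v_scale (r : corner) (x : cornerV) := CornerV (eV_memS (cval r) (vvalP x)).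

Lemma v_addA : associative v_add.
Proof. by move=> x y z; apply: val_inj; rewrite /= addrA. Qed.
Lemma v_addC : commutative v_add.
Proof. by move=> x y; apply: val_inj; rewrite /= addrC. Qed.
Lemma v_add0 : left_id v_zero v_add.
Proof. by move=> x; apply: val_inj; rewrite /= add0r. Qed.
Lemma v_addN : left_inverse v_zero v_opp v_add.
Proof. by move=> x; apply: val_inj; rewrite /= addNr. Qed.

HB.instance Definition _ := GRing.isZmodule.Build cornerV v_addA v_addC v_add0 v_addN.

Lemma v_scaleA a b x : v_scale a (v_scale b x) = v_scale (a * b) x.
Proof. by apply: val_inj; rewrite /= scalerA. Qed.
Lemma v_scale1 : left_id 1 v_scale.
Proof.
move=> x; apply: val_inj => /=.
by have := vvalP x; rewrite eVE => /eqP.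
Qed.
Lemma v_scaleDr : right_distributive v_scale +%R.
Proof. by move=> a x y; apply: val_inj; rewrite /= scalerDr. Qed.
Lemma v_scaleDl x : {morph v_scale^~ x : a b / a + b}.
Proof. by move=> a b; apply: val_inj; rewrite /= scalerDl. Qed.

HB.instance Definition _ := GRing.Zmodule_isLmodule.Build corner cornerV
  v_scaleA v_scale1 v_scaleDr v_scaleDl.

Definition eV : finmod corner := FinMod (@enumP cornerV).

Definition to_corner (a : R) : corner := Corner (corner_memM a corner_mem1).
Definition to_eV (v : V) : eV := CornerV (eV_memZ v).

Lemma vval_additive : additive (vval : eV -> V). Proof. by []. Qed.
HB.instance Definition _ := GRing.isAdditive.Build eV V vval vval_additive.
End Corner.

Section SharpModules.
Variables (C : fieldType) (R : finComPzRingType) (V : finmod R) (e : idem R).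

Definition runit (S : finComPzRingType) (u : S) := [exists v, u * v == 1].

Definition edual : set (dual C V) := [set chi | dact e chi = chi]%classic.

Definition res_dual (chi : dual C V) : dual C (eV e V) :=
  Dual (is_char_comp (@vval R e V : {additive eV e V -> V}) chi).

Definition dorbit (chi : dual C V) : set (dual C V) :=
  [set psi | exists2 u : corner e, runit u & psi = dact (cval u) chi]%classic.

Definition stab (chi : dual C (eV e V)) : {set corner e} :=
  [set u | runit u && (dact u chi == chi)].

Local Notation G := (units (eV e V)).

(* W for the orbit of chi; rho is only evaluated on stab chi, of which it is
   meant to be a character. *)
Definition W (chi : dual C (eV e V)) (rho : corner e -> C) : cmod C G :=
  induced [set g : G | slope (uval g) \in stab chi]
          (fun g => chi (shift (uval g)) * rho (slope (uval g))).

Definition aff_proj (m : aff V) : aff (eV e V) :=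
  Aff (to_corner e (slope m)) (to_eV e (shift m) : eV e V).

Lemma aff_projM m n : aff_proj (m * n)%g = (aff_proj m * aff_proj n)%g.
Proof.
congr Aff; apply: val_inj => /=.
  by rewrite mulrACA idemP.
by rewrite scalerDr !scalerA mulrAC -mulrA idemP mulrC.
Qed.

Lemma aff_proj1 : aff_proj 1%g = 1%g.
Proof. by congr Aff; apply: val_inj; rewrite /= ?mul1r ?scaler0. Qed.

Lemma pideal_subP a : reflect (exists c, c * a = ival e) (pideal e \subset pideal a).
Proof.
apply: (iffP fintype.subsetP) => [/(_ _ (corner_mem1 e))/imsetP[c _ ->] | [c ce] _ /imsetP[r _ ->]].
  by exists c.
by apply/imsetP; exists (r * c); rewrite // -mulrA ce.
Qed.

Lemma aff_proj_unit m : pideal e \subset pideal (slope m) -> munit (aff_proj m).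
Proof.
case/pideal_subP=> c ce; pose n : aff V := Aff c (- (c *: shift m)).
apply/existsP; exists (aff_proj n); rewrite -!aff_projM.
apply/andP; split; apply/eqP; congr Aff; apply: val_inj => /=.
- by rewrite (mulrC (slope m)) ce idemP.
- by rewrite scalerN scalerA (mulrC (slope m)) ce scalerDr scalerN scalerA idemP addNr.
- by rewrite ce idemP.
by rewrite subrr scaler0.
Qed.

Variables (chi : dual C (eV e V)) (rho : corner e -> C).

(* The default value of insubd is never used, by aff_proj_unit. *)
Definition sharp_act (m : aff V) : 'End(W chi rho) :=
  if pideal e \subset pideal (slope m)
  then act (W chi rho) (insubd (1%g : G) (aff_proj m)) else 0.

Lemma uval_insubd m : munit m -> uval (insubd (1%g : G) m) = m.
Proof. by move=> mU; rewrite -[LHS]/(val _) insubdK. Qed.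

Lemma sharp_act1 : sharp_act 1%g = \1%VF.
Proof.
rewrite /sharp_act ifT; last by apply/pideal_subP; exists (ival e); rewrite mulr1.
rewrite -(act1 (W chi rho)); congr (act _ _); apply: val_inj.
by rewrite /= uval_insubd aff_proj1 ?munit1.
Qed.

Lemma sharp_actM m n : sharp_act (m * n)%g = (sharp_act m \o sharp_act n)%VF.
Proof.
have [em | nem] := boolP (pideal e \subset pideal (slope m)); last first.
  rewrite /sharp_act (negPf nem) comp_lfun0l ifF //.
  apply: contraNF nem => /pideal_subP[c ce].
  by apply/pideal_subP; exists (c * slope n); rewrite -mulrA (mulrC (slope n)).
have [en | nen] := boolP (pideal e \subset pideal (slope n)); last first.
  rewrite /sharp_act (negPf nen) comp_lfun0r ifF //.
  apply: contraNF nen => /pideal_subP[c ce].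
  by apply/pideal_subP; exists (c * slope m); rewrite -mulrA.
have emn : pideal e \subset pideal (slope (m * n)%g).
  have [/pideal_subP[c ce] /pideal_subP[d de]] := (em, en).
  by apply/pideal_subP; exists (c * d); rewrite /= mulrACA ce de idemP.
rewrite /sharp_act em en emn -actM; congr (act _ _); apply: val_inj.
by rewrite /= !uval_insubd ?aff_projM //; do ?exact: aff_proj_unit; rewrite -aff_projM;
   apply: aff_proj_unit.
Qed.

Definition Wsharp : cmod C (aff V) := CMod sharp_act1 sharp_actM.
End SharpModules.

Arguments edual C {R} V e.

Definition gidem (R : finComPzRingType) (V : finmod R) (e : idem R) : aff V :=
  Aff (ival e) 0.

(* Main.v *)
Require Import Defs.
From HB Require Import structures.
From mathcomp Require Import all_boot all_order fingroup all_algebra.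
From mathcomp Require Import classical_sets reals complex.

(** For a character chi of V put [charvec chi] = sum_v chi(-v) v in CV and
    [fourier chi f] = sum_v f(v) chi(v).  The first is an eigenvector of the
    translations with eigenvalue chi, and [fourier psi] of (ax+b)f equals
    psi(b) times [fourier (a psi)] of f.  Translations have simple spectrum on
    CV, so a submodule is determined by the set of its vectors [charvec chi],
    and this set is closed under passing from a chi to chi.  Hence the
    characters met in a simple subquotient A/B form one class of the relation
    R chi = R psi, every character is met in exactly one factor of a composition
    series, and isomorphic factors, having the same weights, coincide.

    Let e be the least idempotent with e chi = chi.  If chi = ab chi, then some
    power of ab is an idempotent fixing chi, so e is a multiple of it and ea is
    a unit of Re; thus the class of chi is its U(Re)-orbit.  An affine map of
    slope a acts on A/B as 0 unless e lies in Ra, so the apex is g_e, and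
    sending g in U(Aff(eV)) to g [charvec chi] identifies the induced module W
    with A/B. *)

Set Implicit Arguments.
Unset Strict Implicit.
Unset Printing Implicit Defensive.

Import GRing.Theory Num.Theory.
Local Open Scope ring_scope.

(** * Isomorphisms, quotients and subquotients *)

Section Modules.
Variables (C : fieldType) (M : monoidType).
Implicit Types X Y Z : cmod C M.

Lemma iso_sym X Y : iso X Y -> iso Y X.
Proof.
case=> f [kf imf fM].
have fK : cancel f (f^-1)%VF by apply: lker0_lfunK; rewrite kf.
have gK y : f ((f^-1)%VF y) = y by rewrite limg_lfunVK ?imf ?memvf.
exists (f^-1)%VF; split=> [||m].
- apply/eqP; rewrite -subv0; apply/subvP=> y; rewrite memv_ker memv0 => /eqP gy0.
  by rewrite -[y]gK gy0 linear0.
- apply/eqP; rewrite eqEsubv subvf; apply/subvP=> x _.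
  by rewrite -[x]fK memv_img ?memvf.
apply/lfunP=> y; rewrite !comp_lfunE -{1}[y]gK -[in RHS](fK (act X m _)); congr (_ _).
by have /lfunP/(_ ((f^-1)%VF y)) := fM m; rewrite !comp_lfunE.
Qed.

Lemma iso_trans X Y Z : iso X Y -> iso Y Z -> iso X Z.
Proof.
case=> f [kf imf fM] [g [kg img gM]]; exists (g \o f)%VF; split=> [||m].
- apply/eqP; rewrite -subv0; apply/subvP=> x; rewrite memv_ker comp_lfunE -memv_ker.
  by rewrite kg memv0 -memv_ker kf.
- by rewrite limg_comp imf.
by rewrite -comp_lfunA fM comp_lfunA gM comp_lfunA.
Qed.

Lemma memv_act X (A : submodule X) m x : x \in (A : {vspace X}) -> act X m x \in (A : {vspace X}).
Proof. by move=> Ax; apply: (subvP (sub_stable A m)); apply: memv_img. Qed.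

Lemma actB X m (x y : X) : act X m (x - y) = act X m x - act X m y.
Proof. exact: linearB. Qed.

Lemma actZ X m z (x : X) : act X m (z *: x) = z *: act X m x.
Proof. exact: linearZ. Qed.

Lemma act_sum X m (I : finType) (P : pred I) (F : I -> X) :
  act X m (\sum_(i | P i) F i) = \sum_(i | P i) act X m (F i).
Proof. exact: linear_sum. Qed.

Lemma quotmod_factor X (U : submodule X) (Y : vectType C) (f : 'Hom(X, Y)) :
    lker f = U ->
  exists2 fb : 'Hom(quotmod U, Y), lker fb = 0%VS & forall x, fb (quot_pi U x) = f x.
Proof.
move=> kf; pose fb : 'Hom(quotmod U, Y) := (f \o linfun vsval)%VF.
have fbE w : fb w = f (vsval w) by rewrite comp_lfunE (lfunE vsval).
exists fb => [|x].
  apply/eqP; rewrite -subv0; apply/subvP=> w; rewrite memv_ker fbE memv0 -memv_ker kf => Uw.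
  have: quot_pi U (vsval w) == 0 by rewrite -memv_ker lker_quot_pi.
  by rewrite quot_piK.
apply/esym/eqP; rewrite fbE -subr_eq0 -linearB -memv_ker kf; exact: quot_pi_sub.
Qed.

Section Subquotient.
Variables (X : cmod C M) (A B : submodule X).

(** The canonical surjection from [A], extended to [X] by a linear projection onto [A]; only its
    values on [A] carry meaning. *)
Definition subquot_pi : 'Hom(X, subquot A B) :=
  (quot_pi (Submodule (@trace_stable C M X A B)) \o linfun (vsproj A))%VF.

Lemma subquot_piB x y : subquot_pi (x - y) = subquot_pi x - subquot_pi y.
Proof. exact: linearB. Qed.

Lemma subquot_piZ z x : subquot_pi (z *: x) = z *: subquot_pi x.
Proof. exact: linearZ. Qed.

Lemma subquot_pi_eq0 x : x \in (A : {vspace X}) ->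
  (subquot_pi x == 0) = (x \in (B : {vspace X})).
Proof.
move=> Ax; rewrite /subquot_pi comp_lfunE -memv_ker lker_quot_pi /= /trace_vs.
by rewrite -memv_preim (lfunE (vsproj A)) (lfunE vsval) /= vsprojK.
Qed.

Lemma subquot_pi_act m x : x \in (A : {vspace X}) ->
  subquot_pi (act X m x) = act (subquot A B) m (subquot_pi x).
Proof.
move=> Ax; pose TB := Submodule (@trace_stable C M X A B).
have piE z : subquot_pi z = quot_pi TB (linfun (vsproj A) z) by exact: comp_lfunE.
rewrite [in RHS]piE [RHS](quot_act_pi TB) piE; congr (quot_pi _ _).
apply: subvs_inj; rewrite val_sub_act !(lfunE (vsproj A)) /= !vsprojK //.
exact: memv_act.
Qed.

Lemma subquot_pi_surj y : exists2 x, x \in (A : {vspace X}) & y = subquot_pi x.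
Proof.
exists (vsval (vsval y)); first exact: subvsP.
pose TB := Submodule (@trace_stable C M X A B).
transitivity (quot_pi TB (linfun (vsproj A) (vsval (vsval y)))).
  by rewrite (lfunE (vsproj A)) /= vsvalK -{1}[y](@quot_piK _ _ _ TB).
exact/esym/comp_lfunE.
Qed.

Hypothesis AB_simple : simple (subquot A B).

Lemma simple_subquot_neq : exists2 x, x \in (A : {vspace X}) & x \notin (B : {vspace X}).
Proof.
case: AB_simple => /eqP; rewrite -vpick0 => ny _.
case: (subquot_pi_surj (vpick {: subquot A B})) => x Ax yx; exists x => //.
by rewrite -subquot_pi_eq0 // -yx.
Qed.

(** The image of [D] in [A/B] is a submodule. It is not everything, since with [B <= D] this would
    give [A <= D]; so it is zero. *)
Lemma simple_subquot_between (D : submodule X) : (B <= D)%VS -> (D <= A)%VS ->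
  ~~ (A <= D)%VS -> (D <= B)%VS.
Proof.
move=> sBD sDA nAD.
have stabD m : (act (subquot A B) m @: (subquot_pi @: D) <= subquot_pi @: D)%VS.
  apply/subvP=> _ /memv_imgP[_ /memv_imgP[x Dx ->] ->].
  by rewrite -subquot_pi_act ?(subvP sDA) // memv_img // memv_act.
case: AB_simple => _ /(_ (Submodule stabD)) /= [D0|DT].
  apply/subvP=> x Dx; rewrite -subquot_pi_eq0 ?(subvP sDA) //.
  by rewrite -memv0 -D0 memv_img.
case/negP: nAD; apply/subvP=> x Ax.
have: subquot_pi x \in (subquot_pi @: D)%VS by rewrite DT memvf.
case/memv_imgP=> d Dd /eqP; have Ad := subvP sDA _ Dd.
rewrite -subr_eq0 -linearB (subquot_pi_eq0 (memvB Ax Ad)) => Bxd.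
by rewrite -[x](subrK d) memvD ?(subvP sBD _ Bxd).
Qed.

End Subquotient.
End Modules.

(** * Eigenvectors modulo a subspace *)

Section Eigenvectors.
Variables (C : fieldType) (L : vectType C) (T : 'End(L)).

Lemma iter_lfun_sub i z (f g : L) : iter i T (f - z *: g) = iter i T f - z *: iter i T g.
Proof. by elim: i => //= i ->; rewrite linearB linearZ. Qed.

(** Applying the operators [T - z] one after the other evaluates the product of the [X - z] at
    [T]. *)
Lemma foldl_prod_XsubC (r : seq C) (g : L) :
  foldl (fun h z => T h - z *: h) g r =
  \sum_(i < (size r).+1) (\prod_(z <- r) ('X - z%:P))`_i *: iter i T g.
Proof.
elim: r g => [|z r IHr] g /=.
  by rewrite big_ord_recl big_ord0 big_nil coef1 scale1r addr0.
rewrite IHr big_cons; set q := \prod_(_ <- r) _.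
under [RHS]eq_bigr do rewrite mulrBl coefB coefXM coefCM scalerBl.
(* ['X * q] has no constant term and [q] no coefficient at [(size r).+1], so each sum loses one term
   and both get the same range. *)
rewrite [RHS]sumrB [X in _ = X - _]big_ord_recl /= scale0r add0r.
rewrite [X in _ = _ - X]big_ord_recr /= [q`_(size r).+1]nth_default; last first.
  by rewrite size_prod_XsubC.
rewrite mulr0 scale0r addr0 -sumrB; apply: eq_bigr => i _.
by rewrite iter_lfun_sub scalerBr -iterSr scalerA (mulrC z).
Qed.

(** The fold starts outside [B] and ends inside; the vector just before the first entry is an
    eigenvector modulo [B]. *)
Lemma eigenvector_mod (B : {vspace L}) (P : L -> Prop) (r : seq C) (g : L) :
    (forall h z, P h -> P (T h - z *: h)) -> P g -> g \notin B ->
    foldl (fun h z => T h - z *: h) g r \in B ->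
  exists h z, [/\ P h, h \notin B & T h - z *: h \in B].
Proof.
move=> PT; elim: r g => [|z r IHr] g Pg /= nBg Bg; first by rewrite Bg in nBg.
have [Bz|nBz] := boolP (T g - z *: g \in B); first by exists g, z.
exact: IHr (PT _ _ Pg) nBz Bg.
Qed.

End Eigenvectors.

(** [X^N - 1] splits into linear factors and annihilates [g], so the fold over its roots ends at 0,
    hence in [B]. *)
Lemma finite_order_eigenvector_mod (C : numClosedFieldType) (L : vectType C) (T : 'End(L))
    (B : {vspace L}) (P : L -> Prop) (N : nat) (g : L) :
    (0 < N)%N -> iter N T g = g ->
    (forall h z, P h -> P (T h - z *: h)) -> P g -> g \notin B ->
  exists h z, [/\ P h, h \notin B & T h - z *: h \in B].
Proof.
case: N => [//|N] _ TN PT Pg nBg.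
have [r Dp] := closed_field_poly_normal ('X^(N.+1) - 1 : {poly C}).
rewrite (monicP _) ?monic_Xn_sub_1 // scale1r in Dp.
have szr : size r = N.+1.
  by apply: succn_inj; rewrite -(size_prod_XsubC r id) -Dp size_Xn_sub_1.
apply: (eigenvector_mod (r := r) PT Pg nBg).
rewrite foldl_prod_XsubC -Dp szr big_ord_recr big_ord_recl /= big1 => [|i _].
  rewrite !coefB !coefXn !coef1 eqxx -iterS TN /=.
  by rewrite subr0 sub0r scale1r addr0 scaleN1r addNr mem0v.
by rewrite coefB coefXn coef1 /= /bump leq0n add1n eqSS ltn_eqF //= subrr scale0r.
Qed.

(** * Characters and Fourier coefficients *)

Section Characters.
Variables (C : fieldType) (R : finComPzRingType) (V : finmod R).
Implicit Types (chi psi : dual C V) (a r : R) (v w b : V).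

Lemma dual_ext chi psi : (forall v, chi v = psi v) -> chi = psi.
Proof. by move=> eq_cp; apply/val_inj/ffunP. Qed.

Lemma dual0 chi : chi 0 = 1.
Proof. by have /andP[/eqP] := dualP chi. Qed.

Lemma dualD chi v w : chi (v + w) = chi v * chi w.
Proof. by have /andP[_ /forallP/(_ v)/forallP/(_ w)/eqP] := dualP chi. Qed.

Lemma dualNK chi v : chi (- v) * chi v = 1.
Proof. by rewrite -dualD addNr dual0. Qed.

Lemma dactE r chi v : dact r chi v = chi (r *: v).
Proof. by rewrite ffunE. Qed.

Lemma dactM r a chi : dact (r * a) chi = dact r (dact a chi).
Proof. by apply: dual_ext => v; rewrite !dactE scalerA mulrC. Qed.

Lemma dact1 chi : dact 1 chi = chi.
Proof. by apply: dual_ext => v; rewrite dactE scale1r. Qed.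

Local Notation X := (freemod V C).

Definition fourier_fun chi (f : {ffun V -> C^o}) : C^o := \sum_v f v * chi v.

Lemma fourier_linear chi : linear (fourier_fun chi).
Proof.
move=> a f g; rewrite /fourier_fun scaler_sumr -big_split; apply: eq_bigr => v _.
by rewrite !ffunE mulrDl -scalerAl.
Qed.

HB.instance Definition _ chi := GRing.isLinear.Build C {ffun V -> C^o} C^o *:%R
  (fourier_fun chi) (fourier_linear chi).

Definition fourier chi : 'Hom(X, C^o) := linfun (fourier_fun chi).

Lemma fourierE chi (f : {ffun V -> C^o}) : fourier chi f = \sum_v f v * chi v.
Proof. exact: lfunE. Qed.

Lemma fourierB chi (f g : X) : fourier chi (f - g) = fourier chi f - fourier chi g.
Proof. exact: linearB. Qed.

Lemma fourierZ chi z (f : X) : fourier chi (z *: f) = z * fourier chi f.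
Proof. exact: linearZ. Qed.

Lemma fourier_sum chi (I : finType) (P : pred I) (F : I -> X) :
  fourier chi (\sum_(i | P i) F i) = \sum_(i | P i) fourier chi (F i).
Proof. exact: linear_sum. Qed.

Lemma fourier_act chi (m : aff V) (f : X) :
  fourier chi (act X m f) = chi (shift m) * fourier (dact (slope m) chi) f.
Proof.
rewrite (fourierE chi) (fourierE (dact _ _)) mulr_sumr [RHS](partition_big (aff_eval m) xpredT) //=.
apply: eq_bigr => y _; rewrite lfunE ffunE mulr_suml; apply: eq_bigr => x /eqP <-.
by rewrite /aff_eval dualD dactE [RHS]mulrCA (mulrC (chi (shift m))).
Qed.

(* Spans the chi-eigenspace of the translations in CV. *)
Definition charvec chi : X := [ffun v => chi (- v) : C^o].

Lemma fourier_charvec chi psi :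
  fourier chi (charvec psi) = if psi == chi then #|{: V}|%:R else 0.
Proof.
rewrite fourierE.
have [->|neq] := eqVneq psi chi.
  under eq_bigr do rewrite ffunE dualNK.
  by rewrite sumr_const.
have [w neqw] : exists w, psi w != chi w.
  apply/existsP; apply: contraNT neq; rewrite negb_exists => /forallP eqw.
  by apply/eqP/dual_ext=> v; apply/eqP; rewrite -[_ == _]negbK.
(* Translating the summation variable by [w] multiplies [S] by a factor other than 1, so [S]
   vanishes. *)
apply/eqP; set S := \sum_v _.
have: S = psi (- w) * chi w * S.
  rewrite {1}/S (reindex_inj (addIr w)) mulr_sumr; apply: eq_bigr => v _.
  by rewrite !ffunE opprD !dualD mulrACA mulrC.
move/eqP; rewrite -subr_eq0 -{1}[S]mul1r -mulrBl mulf_eq0 => /orP[|//].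
rewrite subr_eq0 => /eqP e1; case/eqP: neqw.
by rewrite -[psi w]mulr1 e1 mulrA (mulrC (psi w)) dualNK mul1r.
Qed.

(** Averaging against [chi] maps CV into the line of [charvec chi]. Submodules are stable under this
    averaging, which is how [charvec chi] is found inside them. *)
Lemma sum_translates chi (f : X) :
  \sum_b chi (- b) *: act X (Aff 1 b : aff V) f = fourier chi f *: charvec chi.
Proof.
apply/ffunP=> y; rewrite sum_ffunE !ffunE fourierE.
rewrite (reindex_inj (can_inj (subKr y))) /= /GRing.scale /= mulr_suml.
apply: eq_bigr => v _; rewrite ffunE lfunE ffunE (big_pred1 v) => [|x]; last first.
  by rewrite /aff_eval /= scale1r addrCA -subr_eq0 addrAC subrr add0r subr_eq0.
by rewrite opprB dualD /GRing.scale /= [LHS]mulrC mulrA.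
Qed.

End Characters.

(** * Submodules of CV and their weights *)

Section Submodules.
Variables (C : numClosedFieldType) (R : finComPzRingType) (V : finmod R).
Local Notation X := (freemod V C).
Implicit Types (chi psi : dual C V) (A B : submodule X) (x : X) (a : R).

Lemma card_fm_neq0 : #|{: V}|%:R != 0 :> C.
Proof. by rewrite pnatr_eq0 -lt0n; apply/card_gt0P; exists 0. Qed.

Lemma fourier_charvec_neq0 chi : fourier chi (charvec chi) != 0.
Proof. by rewrite fourier_charvec eqxx card_fm_neq0. Qed.

Lemma charvec_mem A chi x : x \in (A : {vspace X}) -> fourier chi x != 0 ->
  charvec chi \in (A : {vspace X}).
Proof.
move=> Ax nz; have: fourier chi x *: charvec chi \in (A : {vspace X}).
  by rewrite -sum_translates; apply: memv_suml => b _; apply/memvZ/memv_act.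
by rewrite rpredZeq (negPf nz).
Qed.

Lemma fourier_out B chi x : charvec chi \notin (B : {vspace X}) ->
  x \in (B : {vspace X}) -> fourier chi x = 0.
Proof.
by move=> nB Bx; apply/eqP; apply: contraNT nB => nz; apply: charvec_mem Bx nz.
Qed.

(** The map [x -> ax] sends [charvec (a chi)] to a vector with nonzero coefficient at [chi]. *)
Lemma charvec_up A a chi : charvec (dact a chi) \in (A : {vspace X}) ->
  charvec chi \in (A : {vspace X}).
Proof.
move=> Aa; apply: (charvec_mem (memv_act (Aff a 0 : aff V) Aa)).
by rewrite fourier_act /= dual0 mul1r fourier_charvec_neq0.
Qed.

(** Modulo [B], averaging [x] against [chi] gives [#|V| x], which is not in [B]; by [sum_translates]
    it also gives [fourier chi x] times [charvec chi]. *)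
Lemma weight_mod B chi x : x \notin (B : {vspace X}) ->
    (forall b, act X (Aff 1 b : aff V) x - chi b *: x \in (B : {vspace X})) ->
  charvec chi \notin (B : {vspace X}) /\ fourier chi x != 0.
Proof.
move=> nBx wx.
have: fourier chi x *: charvec chi - #|{: V}|%:R *: x \in (B : {vspace X}).
  have -> : #|{: V}|%:R *: x = \sum_(b : V) chi (- b) *: (chi b *: x).
    under eq_bigr do rewrite scalerA dualNK scale1r.
    by rewrite sumr_const scaler_nat.
  rewrite -sum_translates -sumrB; apply: memv_suml => b _.
  by rewrite -scalerBr memvZ.
move=> Bd; have nz : #|{: V}|%:R *: x \notin (B : {vspace X}).
  by rewrite rpredZeq (negPf card_fm_neq0).
split; apply: contraNN nz; last first.
  by move=> /eqP f0; move: Bd; rewrite f0 scale0r sub0r memvN.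
by move=> Bc; rewrite -[X in X \in _](subKr (fourier chi x *: charvec chi)) memvB ?memvZ.
Qed.

Lemma mulrn_card_fm (b : V) : b *+ #|{: V}| = 0.
Proof.
apply: (addrI (\sum_(v : V) v)); rewrite addr0 [RHS](reindex_inj (addIr b)) big_split /=.
by rewrite sumr_const.
Qed.

Lemma act_translate0 x : act X (Aff 1 0 : aff V) x = x.
Proof. by rewrite -[LHS]/(act X 1%g x) act1 lfunE. Qed.

Lemma act_translateM b c x :
  act X (Aff 1 b : aff V) (act X (Aff 1 c : aff V) x) = act X (Aff 1 (b + c) : aff V) x.
Proof.
rewrite -[LHS](comp_lfunE (act X _)) -actM; congr (act X _ x).
by congr Aff; rewrite /= ?mulr1 ?scale1r // addrC.
Qed.

Lemma iter_translate (b : V) i x :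
  iter i (act X (Aff 1 b : aff V)) x = act X (Aff 1 (b *+ i) : aff V) x.
Proof.
elim: i => [|i IHi]; first by rewrite mulr0n act_translate0.
by rewrite iterS IHi act_translateM mulrS.
Qed.

(* A common eigenvector of the translations modulo B; its eigenvalues form the
   character sought. *)
Lemma separating_char B x : x \notin (B : {vspace X}) ->
  exists chi, fourier chi x != 0 /\ charvec chi \notin (B : {vspace X}).
Proof.
move=> nBx.
(* Translations are treated one at a time; as they commute, the earlier eigenvector relations
   survive. Keeping the vanishing coefficients of [x] ties the final character to [x]. *)
have eig (l : seq V) : exists (g : X) (lam : V -> C),
    [/\ g \notin (B : {vspace X}), forall psi, fourier psi x = 0 -> fourier psi g = 0
      & {in l, forall c, act X (Aff 1 c : aff V) g - lam c *: g \in (B : {vspace X})}].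
  elim: l => [|b l [g [lam [nBg Fg lg]]]]; first by exists x, (fun=> 0).
  pose P h := (forall psi, fourier psi x = 0 -> fourier psi h = 0)
    /\ {in l, forall c, act X (Aff 1 c : aff V) h - lam c *: h \in (B : {vspace X})}.
  have [|||//|//|h [z [[Fh lh] nBh Bz]]] := @finite_order_eigenvector_mod C X
    (act X (Aff 1 b : aff V)) B P #|{: V}| g.
  - by rewrite lt0n -(pnatr_eq0 C) card_fm_neq0.
  - by rewrite iter_translate mulrn_card_fm act_translate0.
  - move=> h z [Fh lh]; split=> [psi psi0|c lc].
      by rewrite fourierB fourierZ fourier_act /= dact1 Fh // !mulr0 subr0.
    have -> : act X (Aff 1 c : aff V) (act X (Aff 1 b : aff V) h - z *: h)
        - lam c *: (act X (Aff 1 b : aff V) h - z *: h)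
      = act X (Aff 1 b : aff V) (act X (Aff 1 c : aff V) h - lam c *: h)
        - z *: (act X (Aff 1 c : aff V) h - lam c *: h).
      rewrite !actB !actZ !act_translateM (addrC c) !scalerBr !scalerA (mulrC z).
      by rewrite opprD addrACA -opprD.
    by rewrite memvB ?memvZ ?memv_act ?lh.
  exists h, (fun c => if c == b then z else lam c); split=> [||c]; [exact: nBh | exact: Fh |].
  by rewrite inE; have [-> //|_ /lh] := eqVneq c b.
have [g [lam [nBg Fg lg]]] := eig (enum {: V}).
have Bg (c d : C) : c *: g - d *: g \in (B : {vspace X}) -> c = d.
  by rewrite -scalerBl rpredZeq subr_eq0 (negPf nBg) orbF => /eqP.
have {}lg b : act X (Aff 1 b : aff V) g - lam b *: g \in (B : {vspace X}).
  by rewrite lg ?mem_enum.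
have lam0 : lam 0 = 1.
  by apply/esym/Bg; rewrite scale1r -[X in X - _]act_translate0.
have lamD b c : lam (b + c) = lam b * lam c.
  have dist (s t p q : X) : q - p = (t - p) - (t - s) - (s - q).
    by rewrite !opprB (addrC (t - p)) [s - t + _]addrA subrK [RHS]addrC addrA subrK.
  pose t : X := act X (Aff 1 (b + c) : aff V) g.
  pose s : X := lam c *: act X (Aff 1 b : aff V) g.
  have Bts : t - s \in (B : {vspace X}) by rewrite /t /s -act_translateM -actZ -actB memv_act.
  have Bsq : s - (lam b * lam c) *: g \in (B : {vspace X}).
    by rewrite mulrC -scalerA -scalerBr memvZ.
  by apply/esym/Bg; rewrite (dist s t); apply: memvB Bsq; apply: memvB Bts; apply: lg.
have lam_char : is_char [ffun b => lam b].
  rewrite /is_char !ffunE lam0 eqxx; apply/forallP=> b; apply/forallP=> c.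
  by rewrite !ffunE lamD.
have wg b : act X (Aff 1 b : aff V) g - Dual lam_char b *: g \in (B : {vspace X}).
  by rewrite ffunE.
have [nB nz] := weight_mod nBg wg; exists (Dual lam_char); split=> //.
by apply: contraNneq nz => /Fg->.
Qed.

(** For [B <= A], this says that [chi] is a weight of the translations on [A/B]. *)
Definition factor_char A B chi :=
  (charvec chi \in (A : {vspace X})) && (charvec chi \notin (B : {vspace X})).

Lemma factor_char_dact A B a c chi : dact c (dact a chi) = chi ->
  factor_char A B chi -> factor_char A B (dact a chi).
Proof.
move=> ca /andP[Ac nBc]; apply/andP; split; first by apply: (@charvec_up _ c); rewrite ca.
by apply: contraNN nBc; apply: charvec_up.
Qed.

Lemma separating_factor_char A B x : x \in (A : {vspace X}) -> x \notin (B : {vspace X}) ->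
  exists2 chi, factor_char A B chi & fourier chi x != 0.
Proof.
move=> Ax /separating_char[chi [nz nB]]; exists chi => //.
by rewrite /factor_char nB (charvec_mem Ax nz).
Qed.

Lemma factor_char_cyclic A B chi psi : (B <= A)%VS -> simple (subquot A B) ->
  factor_char A B chi -> factor_char A B psi -> exists a, psi = dact a chi.
Proof.
move=> sBA AB_simple /andP[Achi nBchi] /andP[Apsi nBpsi].
(* [K] is a submodule between [B] and [A] that misses [charvec chi], so simplicity puts it inside
   [B]. For [psi] outside [R chi], orthogonality would put [charvec psi] in [K]. *)
pose K : {vspace X} := (A :&: \bigcap_(a : R) lker (fourier (dact a chi)))%VS.
have KP x : reflect (x \in (A : {vspace X}) /\ forall a, fourier (dact a chi) x = 0)
                    (x \in K).
  rewrite memv_cap; apply: (iffP andP) => -[Ax Kx]; (split; first exact: Ax).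
    by move=> a; move: Kx; rewrite memvE => /subv_bigcapP/(_ a isT); rewrite -memvE memv_ker => /eqP.
  by rewrite memvE; apply/subv_bigcapP=> a _; rewrite -memvE memv_ker Kx.
have K_stable m : (act X m @: K <= K)%VS.
  apply/subvP=> _ /memv_imgP[x /KP[Ax Kx] ->]; apply/KP; split=> [|a]; first exact: memv_act.
  by rewrite fourier_act -dactM Kx mulr0.
have nKpsi : charvec psi \notin K.
  apply: contraNN nBpsi; apply: subvP; apply: (simple_subquot_between AB_simple
    (D := Submodule K_stable)) => /=; last 1 first.
  - apply: contraNN (fourier_charvec_neq0 chi) => /subvP/(_ _ Achi)/KP[_ /(_ 1)].
    by rewrite dact1 => ->.
  - apply/subvP=> x Bx; apply/KP; split=> [|a]; first exact: (subvP sBA).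
    apply: fourier_out Bx; apply: contraNN nBchi; exact: charvec_up.
  - exact: capvSl.
have [/existsP[a /eqP-> //]|] := boolP [exists a, psi == dact a chi]; first by exists a.
rewrite negb_exists => /forallP npsi; case/negP: nKpsi; apply/KP; split=> // a.
by rewrite fourier_charvec (negPf (npsi a)).
Qed.

End Submodules.

(** * Idempotents fixing a character, and unit orbits *)

Section Idempotents.
Variables (C : fieldType) (R : finComPzRingType) (V : finmod R).
Implicit Types (chi psi : dual C V) (a c : R) (e f : idem R).

Lemma idem_power a : exists2 k, (0 < k)%N & a ^+ k * a ^+ k = a ^+ k.
Proof.
have [i [p [p0 aip]]] : exists i p, (0 < p)%N /\ a ^+ (i + p) = a ^+ i.
  have /injectivePn[i [j neq_ij aij]] : ~~ injectiveb (fun i : 'I_#|R|.+1 => a ^+ i).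
    by apply/injectiveP=> /leq_card; rewrite card_ord ltnn.
  wlog lt_ij : i j neq_ij aij / (i < j)%N.
    move=> IH; case: (ltngtP i j) => [|/IH|/val_inj/eqP]; last by rewrite (negPf neq_ij).
      exact: IH.
    by apply=> //; rewrite eq_sym.
  by exists i, (j - i)%N; rewrite subn_gt0 subnKC // ltnW.
have step n : (i <= n)%N -> a ^+ (n + p) = a ^+ n.
  by move=> le_in; rewrite -(subnK le_in) -addnA !exprD -exprD aip.
have per k n : (i <= n)%N -> a ^+ (n + k * p) = a ^+ n.
  elim: k n => [|k IHk] n le_in; first by rewrite mul0n addn0.
  by rewrite mulSn addnA IHk ?step // (leq_trans le_in) ?leq_addr.
(* A multiple of the period [p] that is at least [i]; taking [i.+1] keeps it positive when
   [i = 0]. *)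
exists (i.+1 * p)%N; first by rewrite muln_gt0.
by rewrite -exprD per // (leq_trans (leqnSn i)) ?leq_pmulr.
Qed.

(** The second condition means that [Re] lies in [Rf]: [e] is the least idempotent fixing [chi]. *)
Definition min_idem e chi :=
  dact e chi = chi /\ forall f, dact f chi = chi -> exists c, c * ival f = ival e.

(** Choose [e0] with the smallest ideal. For any other [f], the idempotent [e0 f] also fixes [chi]
    and generates a subideal of [R e0], hence all of it. *)
Lemma exists_min_idem chi : exists e, min_idem e chi.
Proof.
pose P (f : R) := (f * f == f) && (dact f chi == chi).
have P1 : P 1 by rewrite /P mulr1 dact1 !eqxx.
case: (arg_minnP (fun r : R => #|pideal r|) P1) => e0 /andP[/eqP ee /eqP echi] emin.
exists (Idem ee); split=> // f fchi.
have Pef : P (e0 * ival f).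
  by rewrite /P mulrACA ee idemP dactM fchi echi !eqxx.
have /eqP eq_ef : pideal (e0 * ival f) == pideal e0.
  rewrite eqEcard emin // andbT; apply/fintype.subsetP=> _ /imsetP[r _ ->].
  by apply/imsetP; exists (r * ival f); rewrite // -mulrA (mulrC e0).
have: e0 \in pideal (e0 * ival f) by rewrite eq_ef; apply/imsetP; exists 1; rewrite ?mul1r.
by case/imsetP=> r _ e0E; exists (r * e0); rewrite /= -mulrA -e0E.
Qed.

(** Some positive power of [a] is an idempotent fixing [chi], so [e] is a multiple of that power. *)
Lemma min_idem_dvd e chi a : min_idem e chi -> dact a chi = chi -> exists c, c * a = ival e.
Proof.
move=> [_ emin] achi; have [[//|k] _ ak] := idem_power a.
have akchi n : dact (a ^+ n) chi = chi.
  by elim: n => [|n IHn]; rewrite ?expr0 ?dact1 // exprS dactM IHn.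
have [c ce] := emin (Idem ak) (akchi _).
by exists (c * a ^+ k); rewrite -mulrA -exprSr.
Qed.

Lemma min_idem_dact e chi a c : dact c (dact a chi) = chi -> min_idem e chi ->
  min_idem e (dact a chi).
Proof.
move=> ca [echi emin]; split=> [|f fchi]; first by rewrite -dactM mulrC dactM echi.
by apply: emin; rewrite -ca -dactM mulrC dactM fchi.
Qed.

Lemma corner_unitP e (u : corner e) : runit u -> exists w : corner e, cval w * cval u = ival e.
Proof. by case/existsP=> w /eqP uw; exists w; rewrite mulrC -[LHS]/(cval (u * w)) uw. Qed.

Lemma min_idem_dorbit e chi psi : min_idem e chi -> dorbit e chi psi -> min_idem e psi.
Proof.
move=> emin [u /corner_unitP[w wu] ->]; apply: (@min_idem_dact e _ _ (cval w)) => //.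
by rewrite -dactM wu emin.1.
Qed.

Lemma dorbit_sym e chi psi : dact e chi = chi -> dorbit e chi psi -> dorbit e psi chi.
Proof.
move=> echi [u /existsP[w /eqP uw] ->]; exists w.
  by apply/existsP; exists u; rewrite mulrC uw.
by rewrite -dactM mulrC -[X in dact X _]/(cval (u * w)) uw.
Qed.

Lemma dorbit_trans e chi psi phi : dorbit e chi psi -> dorbit e psi phi -> dorbit e chi phi.
Proof.
move=> [u /existsP[u' /eqP uu] ->] [w /existsP[w' /eqP ww] ->]; exists (w * u).
  by apply/existsP; exists (u' * w'); rewrite mulrA -(mulrA w) uu mulr1 ww.
by rewrite -dactM.
Qed.

Lemma dorbit_edual e chi psi : dact e chi = chi -> dorbit e chi psi -> dact e psi = psi.
Proof. by move=> echi [u _ ->]; rewrite -dactM mulrC dactM echi. Qed.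

End Idempotents.

(** * Relations of an induced module *)

Section Induced.
Variables (C : numFieldType) (G : finGroupType) (H : {set G}) (lam : G -> C).

Lemma ffun_sum_delta (T : finType) (F : {ffun T -> C^o}) : F = \sum_x F x *: delta C x.
Proof.
apply/ffunP=> y; rewrite sum_ffunE (bigD1 y) //= big1 => [|x /negPf neq]; rewrite !ffunE.
  by rewrite eqxx addr0 /GRing.scale /= mulr1.
by rewrite neq /GRing.scale /= mulr0.
Qed.

(* Modulo the relations, #|H| F is the sum of the F g lam(h)^-1 gh, whose
   coordinates are the sums assumed to vanish. *)
Lemma mem_ind_rel (lamV : G -> C) (F : regmod C G) :
    H != finset.set0 -> {in H, forall h, lamV h * lam h = 1} ->
    (forall x : G, \sum_(g | (g^-1 * x)%g \in H)
       (F : {ffun G -> C^o}) g * lamV (g^-1 * x)%g = 0) ->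
  F \in <<ind_rel H lam>>%VS.
Proof.
move=> nH lamK F0; pose Fc := (F : {ffun G -> C^o}).
have nzH : #|H|%:R != 0 :> C by rewrite pnatr_eq0 -lt0n card_gt0.
suff: #|H|%:R *: F \in <<ind_rel H lam>>%VS by rewrite rpredZeq (negPf nzH).
pose D : regmod C G := \sum_g \sum_(h in H) (Fc g * lamV h) *: delta C (g * h)%g.
have -> : #|H|%:R *: F = #|H|%:R *: F - D.
  suff -> : D = 0 by rewrite subr0.
  apply/ffunP=> x; rewrite /D sum_ffunE ffunE -[RHS](F0 x) [RHS]big_mkcond /=.
  apply: eq_bigr => g _; rewrite sum_ffunE.
  case: ifPn => Hgx; last first.
    rewrite big1 // => h Hh; rewrite !ffunE; case: eqP => [ghx|]; last by rewrite scaler0.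
    by case/negP: Hgx; rewrite -ghx mulKg.
  rewrite (bigD1 (g^-1 * x)%g) //= !ffunE mulKVg eqxx /GRing.scale /= mulr1 big1 ?addr0 // => h.
  case/andP=> _ /negPf neq; rewrite !ffunE; case: eqP => [ghx|]; last by rewrite scaler0.
  by rewrite -ghx mulKg eqxx in neq.
have -> : #|H|%:R *: F = \sum_g \sum_(h in H) Fc g *: delta C g.
  transitivity (#|H|%:R *: \sum_g Fc g *: delta C g); first by rewrite -ffun_sum_delta.
  rewrite scaler_sumr; apply: eq_bigr => g _.
  by rewrite sumr_const scaler_nat.
rewrite /D -sumrB; apply: memv_suml => g _; rewrite -sumrB; apply: memv_suml => h Hh.
have -> : Fc g *: delta C g - (Fc g * lamV h) *: delta C (g * h)%g
  = - (Fc g * lamV h) *: (delta C (g * h)%g - lam h *: delta C g).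
  by rewrite scaleNr scalerBr opprB scalerA -mulrA lamK // mulr1.
by apply/memvZ/memv_span/fintype.imageP; exists (g, h).
Qed.

End Induced.

(** * Weights of one simple factor *)

Section FactorCharacters.
Variables (C : numClosedFieldType) (R : finComPzRingType) (V : finmod R).
Local Notation X := (freemod V C).
Variables (A B : submodule X).
Hypotheses (sBA : (B <= A)%VS) (AB_simple : simple (subquot A B)).
Variables (e : idem R) (chi : dual C V).
Hypotheses (ABchi : factor_char A B chi) (min_e : min_idem e chi).
Implicit Types (psi : dual C V) (a : R).

(** Each weight is a multiple of the other, say by [a] and [b], so [ba] fixes [chi] and [e = cba].
    Then [ea] is a unit of [Re] with inverse [cbe], and it acts on [chi] as [a] does. *)
Lemma factor_char_dorbit psi : factor_char A B psi -> dorbit e chi psi.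
Proof.
move=> ABpsi; have [a psiE] := factor_char_cyclic sBA AB_simple ABchi ABpsi.
have [b chiE] := factor_char_cyclic sBA AB_simple ABpsi ABchi.
have [|c ce] := @min_idem_dvd _ _ _ e chi (b * a) min_e.
  by rewrite dactM -psiE -chiE.
exists (to_corner e a).
  apply/existsP; exists (to_corner e (c * b)); apply/eqP/val_inj => /=.
  by rewrite mulrACA idemP (mulrC a) -[c * b * a]mulrA ce idemP.
by rewrite /= dactM min_e.1.
Qed.

Lemma dorbit_factor_char psi : dorbit e chi psi -> factor_char A B psi.
Proof.
case=> u /corner_unitP[w wu] ->; apply: (@factor_char_dact _ _ _ A B _ (cval w)) => //.
by rewrite -dactM wu min_e.1.
Qed.

Lemma factor_char_min psi : factor_char A B psi -> min_idem e psi.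
Proof. by move/factor_char_dorbit; apply: min_idem_dorbit. Qed.

Lemma factor_char_dvd psi a : factor_char A B psi -> factor_char A B (dact a psi) ->
  exists c, c * a = ival e.
Proof.
move=> ABpsi ABa; have [b psiE] := factor_char_cyclic sBA AB_simple ABa ABpsi.
have [|c ce] := @min_idem_dvd _ _ _ e psi (b * a) (factor_char_min ABpsi).
  by rewrite dactM -psiE.
by exists (c * b); rewrite -mulrA.
Qed.

Lemma factor_char_act (m : aff V) (x : X) psi : x \in (A : {vspace X}) ->
    factor_char A B psi -> fourier psi (act X m x) != 0 ->
  factor_char A B (dact (slope m) psi).
Proof.
move=> Ax /andP[_ nB]; rewrite fourier_act mulf_eq0 negb_or => /andP[_ nz].
by rewrite /factor_char (charvec_mem Ax nz); apply: contraNN nB; apply: charvec_up.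
Qed.

(** Every weight is fixed by [e], so [g_e x - x] has zero coefficient at each weight and lies in
    [B]. *)
Lemma act_subquot_gidem y : act (subquot A B) (gidem V e) y = y.
Proof.
have [x Ax ->] := subquot_pi_surj y; rewrite -subquot_pi_act //.
apply/eqP; rewrite -subr_eq0 -linearB subquot_pi_eq0; last by rewrite memvB ?memv_act.
apply/negPn/negP; move/(separating_factor_char (memvB (memv_act _ Ax) Ax)) => [psi ABpsi].
by rewrite fourierB fourier_act dual0 mul1r (factor_char_min ABpsi).1 subrr eqxx.
Qed.

(** A weight [psi] seen in [m x] makes [(slope m) psi] a weight too, which forces [e] into
    [R (slope m)]. *)
Lemma act_subquot_eq0 (m : aff V) y : ~ (exists c, c * slope m = ival e) ->
  act (subquot A B) m y = 0.
Proof.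
move=> ndvd; have [x Ax ->] := subquot_pi_surj y; rewrite -subquot_pi_act //.
apply/eqP; rewrite (subquot_pi_eq0 B (memv_act m Ax)); apply/negPn/negP.
move/(separating_factor_char (memv_act _ Ax)) => [psi ABpsi /(factor_char_act Ax ABpsi) ABm].
exact/ndvd/(factor_char_dvd ABpsi ABm).
Qed.

End FactorCharacters.

(** * Identifying a factor with the inflated induced module *)

Section FactorIso.
Variables (C : numClosedFieldType) (R : finComPzRingType) (V : finmod R).
Local Notation X := (freemod V C).
Variables (A B : submodule X).
Hypotheses (sBA : (B <= A)%VS) (AB_simple : simple (subquot A B)).
Variables (e : idem R) (chi : dual C V).
Hypotheses (ABchi : factor_char A B chi) (min_e : min_idem e chi).
Local Notation G := (units (eV e V)).

(** Realises U(Aff(eV)) as the unit group of the monoid [g_e Aff(V) g_e], whose identity is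
    [g_e]. *)
Definition unit_lift (g : G) : aff V :=
  Aff (cval (slope (uval g))) (vval (shift (uval g))).

Lemma unit_liftM (g h : G) : unit_lift (g * h)%g = (unit_lift g * unit_lift h)%g.
Proof. by []. Qed.

Lemma unit_lift1 : unit_lift 1%g = gidem V e.
Proof. by []. Qed.

Lemma unit_lift_proj (m : aff V) : pideal e \subset pideal (slope m) ->
  unit_lift (insubd (1%g : G) (aff_proj e m)) = (gidem V e * m)%g.
Proof.
move=> em; rewrite /unit_lift uval_insubd ?aff_proj_unit //.
by congr Aff; rewrite /= ?addr0 // mulrC.
Qed.

Local Notation slp g := (slope (unit_lift g)).

Lemma slpV g : slp g^-1%g * slp g = ival e.
Proof. by rewrite -[LHS]/(slope (unit_lift g^-1 * unit_lift g)%g) -unit_liftM mulVg. Qed.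

Definition ind_grp : {set G} := [set g : G | slope (uval g) \in stab (res_dual e chi)].
(** The factor 1 is the value of the trivial character; it keeps the term convertible with the one
    in [W]. *)
Definition ind_char (g : G) : C := res_dual e chi (shift (uval g)) * 1.

Lemma ind_charE g : ind_char g = chi (shift (unit_lift g)).
Proof. by rewrite /ind_char mulr1 ffunE. Qed.

Lemma mem_ind_grp g : (g \in ind_grp) = (dact (slp g) chi == chi).
Proof.
have gu : runit (slope (uval g)).
  apply/existsP; exists (slope (uval g^-1%g)); apply/eqP.
  by rewrite -[LHS]/(slope (uval (g * g^-1)%g)) mulgV.
rewrite !inE gu /=; apply/eqP/eqP=> [gchi | gchi]; last first.
  by apply: dual_ext => v; rewrite dactE !ffunE -[in RHS]gchi dactE.
apply: dual_ext => v; rewrite -min_e.1 !dactE scalerA.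
have /(congr1 (fun psi : dual C (eV e V) => psi (to_eV e v))) := gchi.
by rewrite dactE !ffunE /= scalerA (mulrC (cval _)).
Qed.

Definition unit_orbit_fun (F : {ffun G -> C^o}) : X :=
  \sum_g F g *: act X (unit_lift g) (charvec chi).

Lemma unit_orbit_linear : linear unit_orbit_fun.
Proof.
move=> a F F'; rewrite /unit_orbit_fun scaler_sumr -big_split; apply: eq_bigr => g _.
by rewrite !ffunE scalerDl scalerA.
Qed.

HB.instance Definition _ := GRing.isLinear.Build C {ffun G -> C^o} X *:%R
  unit_orbit_fun unit_orbit_linear.

Definition unit_orbit : 'Hom(regmod C G, X) := linfun unit_orbit_fun.

Lemma unit_orbitE (F : {ffun G -> C^o}) :
  unit_orbit F = \sum_g F g *: act X (unit_lift g) (charvec chi).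
Proof. exact: lfunE. Qed.

Lemma unit_orbit_delta g : unit_orbit (delta C g) = act X (unit_lift g) (charvec chi).
Proof.
rewrite unit_orbitE (bigD1 g) //= ffunE eqxx scale1r big1 ?addr0 // => h /negPf neq.
by rewrite ffunE eq_sym neq scale0r.
Qed.

Lemma unit_orbitB F F' : unit_orbit (F - F') = unit_orbit F - unit_orbit F'.
Proof. exact: linearB. Qed.

Lemma unit_orbitZ z F : unit_orbit (z *: F) = z *: unit_orbit F.
Proof. exact: linearZ. Qed.

Lemma act_unit_liftM g h (x : X) :
  act X (unit_lift (g * h)%g) x = act X (unit_lift g) (act X (unit_lift h) x).
Proof. by rewrite unit_liftM actM comp_lfunE. Qed.

Lemma unit_orbit_act g (F : regmod C G) :
  unit_orbit (act (regmod C G) g F) = act X (unit_lift g) (unit_orbit F).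
Proof.
rewrite [in RHS](unit_orbitE F) act_sum unit_orbitE.
rewrite [RHS](partition_big (fun h => (g * h)%g) xpredT) //.
apply: eq_bigr => y _; rewrite lfunE ffunE scaler_suml; apply: eq_bigr => h /eqP <-.
by rewrite act_unit_liftM actZ.
Qed.

Lemma unit_orbit_mem F : unit_orbit F \in (A : {vspace X}).
Proof.
rewrite unit_orbitE; apply: memv_suml => g _; apply/memvZ/memv_act.
by case/andP: ABchi.
Qed.

(** All weights lie in the orbit of [chi], so by commutativity the slope of [g] fixes each of them,
    and both vectors have equal coefficients there. This is why the character of the stabiliser is
    trivial. *)
Lemma ind_grp_weight g : g \in ind_grp ->
  act X (unit_lift g) (charvec chi) - ind_char g *: charvec chi \in (B : {vspace X}).
Proof.
rewrite mem_ind_grp => /eqP gchi; have /andP[Achi _] := ABchi.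
apply/negPn/negP; case/(@separating_factor_char _ _ _ A) => [|psi ABpsi].
  by rewrite memvB ?memvZ ?memv_act.
rewrite fourierB fourierZ fourier_act ind_charE !fourier_charvec.
have [w _ psiE] := factor_char_dorbit sBA AB_simple ABchi min_e ABpsi.
have gpsi : dact (slp g) psi = psi by rewrite psiE -dactM mulrC dactM gchi.
by rewrite gpsi; case: (chi =P psi) => [<-|_]; rewrite ?mulr0 subrr eqxx.
Qed.

Definition unit_orbit_factor : 'Hom(regmod C G, subquot A B) :=
  (subquot_pi A B \o unit_orbit)%VF.

Lemma unit_orbit_factorE F : unit_orbit_factor F = subquot_pi A B (unit_orbit F).
Proof. exact: comp_lfunE. Qed.

Lemma mem_lker_unit_orbit_factor F :
  (F \in lker unit_orbit_factor) = (unit_orbit F \in (B : {vspace X})).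
Proof. by rewrite memv_ker -(subquot_pi_eq0 B (unit_orbit_mem F)) -unit_orbit_factorE. Qed.

(** The relations hold by [ind_grp_weight]. Conversely, an element sent into [B] has zero
    coefficients at all weights, and these are, up to nonzero factors, the sums in [mem_ind_rel]. *)
Lemma lker_unit_orbit_factor : lker unit_orbit_factor = <<ind_rel ind_grp ind_char>>%VS.
Proof.
apply/eqP; rewrite eqEsubv; apply/andP; split; last first.
  apply/span_subvP=> F; rewrite /ind_rel; case/fintype.imageP=> -[g h] Hh ->.
  have orbE : unit_orbit (delta C (g * h)%g - ind_char h *: delta C g) =
      act X (unit_lift g) (act X (unit_lift h) (charvec chi) - ind_char h *: charvec chi).
    rewrite unit_orbitB unit_orbitZ actB actZ -act_unit_liftM.
    by congr (_ - _ *: _); apply: unit_orbit_delta.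
  rewrite mem_lker_unit_orbit_factor [unit_orbit _]orbE.
  exact/memv_act/ind_grp_weight.
apply/subvP=> F; rewrite mem_lker_unit_orbit_factor => BF.
apply: (@mem_ind_rel _ _ _ _ (fun h => chi (- shift (unit_lift h)))).
- by apply/set0Pn; exists 1%g; rewrite mem_ind_grp unit_lift1 min_e.1.
- by move=> h _; rewrite ind_charE dualNK.
(* The coefficient at [psi] isolates the coset of [x]: on the image of [charvec chi] under [g] it is
   nonzero exactly when [g^-1 x] is in [ind_grp]. *)
move=> x; pose psi := dact (slp x^-1%g) chi.
have nBpsi : charvec psi \notin (B : {vspace X}).
  have /andP[_] // : factor_char A B psi.
  apply: (@factor_char_dact _ _ _ A B _ (slp x)) => //.
  by rewrite -dactM mulrC slpV min_e.1.
have Hgx g : ((g^-1 * x)%g \in ind_grp) = (chi == dact (slp g) psi).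
  rewrite mem_ind_grp /psi -dactM unit_liftM /=.
  have gxK : slp g^-1%g * slp x * (slp g * slp x^-1%g) = ival e.
    by rewrite mulrACA slpV (mulrC (slp x)) slpV idemP.
  apply/eqP/eqP=> gx.
    by rewrite -{2}gx -dactM mulrC gxK min_e.1.
  by rewrite {1}gx -dactM gxK min_e.1.
have := fourier_out nBpsi BF; rewrite unit_orbitE fourier_sum.
under eq_bigr do rewrite fourierZ fourier_act fourier_charvec -Hgx.
rewrite (bigID (fun g => (g^-1 * x)%g \in ind_grp)) /= addrC big1 ?add0r; last first.
  by move=> g /negPf->; rewrite !mulr0.
(* Since [x = g (g^-1 x)], this factor turns [psi] at the shift of [g] into [chi] at minus the shift
   of [g^-1 x]. *)
move=> sum0; apply/eqP; have /eqP := congr1 ( *%R (psi (- shift (unit_lift x)))) sum0.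
rewrite mulr0 mulr_sumr.
have -> : \sum_(g | (g^-1 * x)%g \in ind_grp) psi (- shift (unit_lift x)) *
    ((F : {ffun G -> C^o}) g * (psi (shift (unit_lift g)) *
      (if (g^-1 * x)%g \in ind_grp then #|{: V}|%:R else 0)))
  = \sum_(g | (g^-1 * x)%g \in ind_grp)
      (F : {ffun G -> C^o}) g * chi (- shift (unit_lift (g^-1 * x)%g)) * #|{: V}|%:R.
  apply: eq_bigr => g Hg; rewrite Hg mulrCA !mulrA -[_ * psi _ * psi _]mulrA -dualD.
  have := Hgx g; rewrite Hg => /esym/eqP ->; rewrite dactE; congr (_ * psi _ * _).
  rewrite -{1}[x](mulKVg g) unit_liftM /= scalerN.
  by rewrite opprD addrNK.
by rewrite -mulr_suml mulf_eq0 (negPf (card_fm_neq0 C V)) orbF.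
Qed.

(** If [e] lies in [R (slope m)], then [m] acts on [W] through the lift [g_e m], and [g_e] is the
    identity on [A/B]; otherwise [m] acts as 0 on both sides. *)
Lemma factor_iso : iso (subquot A B) (Wsharp (res_dual e chi) (fun=> 1)).
Proof.
apply: iso_sym; pose I := Submodule (@ind_rel_stable C G ind_grp ind_char).
have [fb kfb fbE] := @quotmod_factor _ _ _ I _ _ lker_unit_orbit_factor.
have fbM m w : fb (act (Wsharp (res_dual e chi) (fun=> 1)) m w) = act (subquot A B) m (fb w).
  have -> : w = quot_pi I (vsval w) by rewrite quot_piK.
  move: (vsval w) => F; rewrite [act (Wsharp _ _) m]/= /sharp_act.
  case: (pideal_subP e (slope m)) => [em|nem]; last first.
    by rewrite zero_lfunE linear0 (act_subquot_eq0 sBA AB_simple ABchi min_e).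
  rewrite [act (W _ _) _ _](quot_act_pi I) !fbE !unit_orbit_factorE unit_orbit_act.
  rewrite unit_lift_proj; last exact/pideal_subP.
  rewrite subquot_pi_act ?unit_orbit_mem // actM comp_lfunE.
  by rewrite (act_subquot_gidem sBA AB_simple ABchi min_e).
exists fb; split=> [||m]; first exact: kfb; last first.
  by apply/lfunP=> w; apply: etrans (comp_lfunE _ _ _) (etrans (fbM m w) (esym (comp_lfunE _ _ _))).
(* Surjectivity follows from simplicity, as the image contains the nonzero class of
   [charvec chi]. *)
have img_stable m : (act (subquot A B) m @: limg fb <= limg fb)%VS.
  by apply/subvP=> _ /memv_imgP[_ /memv_imgP[w _ ->] ->]; rewrite -fbM memv_img ?memvf.
case: AB_simple => _ /(_ (Submodule img_stable)) /= [fb0|//].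
have /andP[Achi nBchi] := ABchi.
case/negP: nBchi; rewrite -(subquot_pi_eq0 B Achi) -memv0 -fb0.
rewrite -(act_subquot_gidem sBA AB_simple ABchi min_e (subquot_pi A B (charvec chi))).
rewrite -subquot_pi_act //.
by rewrite -unit_lift1 -(unit_orbit_delta 1%g) -unit_orbit_factorE -fbE memv_img ?memvf.
Qed.

End FactorIso.

(** * Apexes and composition series *)

Section Apex.
Variables (C : numClosedFieldType) (R : finComPzRingType) (V : finmod R).
Local Notation X := (freemod V C).
Implicit Types (A B : submodule X) (chi psi : dual C V) (e f : idem R).

Lemma act_charvec chi (b : V) :
  act X (Aff 1 b : aff V) (charvec chi) = chi b *: charvec chi.
Proof.
apply/ffunP=> y; rewrite lfunE !ffunE (big_pred1 (y - b)) => [|x]; last first.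
  by rewrite /aff_eval /= scale1r eq_sym -subr_eq eq_sym.
by rewrite ffunE opprB dualD.
Qed.

(** A lift to [A] of the image of [charvec chi] is an eigenvector modulo [B] with eigenvalue [chi],
    so [weight_mod] applies. *)
Lemma iso_factor_char A B A' B' chi : iso (subquot A B) (subquot A' B') ->
  factor_char A' B' chi -> factor_char A B chi.
Proof.
move/iso_sym=> [f [kf _ fM]] /andP[A'chi nB'chi].
have [x Ax fx] := subquot_pi_surj (f (subquot_pi A' B' (charvec chi))).
have nBx : x \notin (B : {vspace X}).
  by rewrite -(subquot_pi_eq0 B Ax) -fx -memv_ker kf memv0 subquot_pi_eq0.
have wx b : act X (Aff 1 b : aff V) x - chi b *: x \in (B : {vspace X}).
  rewrite -(subquot_pi_eq0 B (memvB (memv_act _ Ax) (memvZ _ Ax))).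
  rewrite subquot_piB subquot_piZ subr_eq0 subquot_pi_act // -fx; apply/eqP.
  have /lfunP/(_ (subquot_pi A' B' (charvec chi))) := fM (Aff 1 b : aff V).
  move=> fMchi; apply: etrans (esym (etrans (esym (comp_lfunE _ _ _))
    (etrans fMchi (comp_lfunE _ _ _)))) _.
  by rewrite -subquot_pi_act // act_charvec subquot_piZ; apply: linearZ.
have [nB nz] := weight_mod nBx wx.
by rewrite /factor_char nB (charvec_mem Ax nz).
Qed.

Lemma gidem_factorP e (m : aff V) :
  (exists x y, gidem V e = (x * m * y)%g) <-> (exists c, c * slope m = ival e).
Proof.
split=> [[x [y gE]]|[c ce]].
  exists (slope x * slope y); rewrite mulrAC.
  exact: (esym (congr1 (@slope _ _) gE)).
(* The shift cancels that of [m] after scaling by [c]. *)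
exists (Aff c (- (c *: shift m))), 1%g; rewrite mulg1.
by congr Aff; rewrite /= ?ce // subrr.
Qed.

(** Let [e'] be the least idempotent fixing [chi]. Neither [g_e] nor [g_e'] acts as 0, so [e] and
    [e'] divide each other; idempotents of a commutative ring with the same ideal are equal. *)
Lemma apex_min_idem A B e chi : (B <= A)%VS -> simple (subquot A B) ->
  factor_char A B chi -> apex (gidem V e) (subquot A B) -> min_idem e chi.
Proof.
move=> sBA AB_simple ABchi [_ nz vanish]; have [e' min_e'] := exists_min_idem chi.
have [c ce] : exists c, c * ival e = ival e'.
  apply/(pideal_subP e')/negPn/negP => /(pideal_subP e') ndvd; apply: nz.
  apply/lfunP=> y; rewrite zero_lfunE.
  exact: (act_subquot_eq0 sBA AB_simple ABchi min_e').
have [d de] : exists d, d * ival e' = ival e.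
  apply/(pideal_subP e)/negPn/negP => /(pideal_subP e) ndvd.
  have g0 : act (subquot A B) (gidem V e') = 0 by apply: vanish => /gidem_factorP.
  have /andP[Achi /negP[]] := ABchi; rewrite -(subquot_pi_eq0 B Achi).
  rewrite -[X in X == 0](act_subquot_gidem sBA AB_simple ABchi min_e').
  by rewrite g0 zero_lfunE.
have eqe : ival e = ival e'.
  by rewrite -[LHS]de -{1}[ival e']idemP mulrA de mulrC -[in LHS]ce -mulrA idemP.
by case: min_e' => e'chi e'min; split=> [|f]; rewrite eqe //; apply: e'min.
Qed.

(** Translates leastness into the condition that selects orbits. For the converse, the least
    idempotent of [chi] generates an ideal inside [Re], but not properly inside. *)
Lemma min_idemP e chi : min_idem e chi <->
  dact e chi = chi /\ forall f, pideal f \proper pideal e -> dact f chi <> chi.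
Proof.
split=> [[echi emin]|[echi eprop]].
  split=> // f /properP[_ [x ex nfx]] /emin/(pideal_subP e)/fintype.subsetP sef.
  by rewrite sef in nfx.
split=> // f fchi; have [e' [e'chi e'min]] := exists_min_idem chi.
have [c ce] : exists c, c * ival e' = ival e.
  apply/(pideal_subP e)/negPn/negP => nsub; apply: (eprop e') => //.
  by rewrite properE nsub andbT; apply/(pideal_subP e')/e'min.
have [d de] := e'min f fchi.
by exists (c * d); rewrite -mulrA de.
Qed.

Lemma dorbit_eq e chi psi : dact e chi = chi -> dorbit e chi psi ->
  dorbit e chi = dorbit e psi.
Proof.
move=> echi chipsi; apply/seteqP; split=> phi.
  by apply: dorbit_trans; apply: dorbit_sym.
exact: dorbit_trans.
Qed.

Lemma apex_Wsharp A B e chi (Y := Wsharp (res_dual e chi) (fun=> 1)) :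
    simple (subquot A B) -> iso (subquot A B) Y ->
  apex (gidem V e) Y.
Proof.
move=> [nzAB _] [f [kf _ fM]]; split.
- by congr Aff; rewrite /= ?idemP // scaler0 addr0.
- have g1 : act Y (gidem V e) = \1%VF.
    rewrite -[LHS]/(sharp_act (res_dual e chi) (fun=> 1) (gidem V e)) /sharp_act subxx.
    apply: etrans (act1 (W (res_dual e chi) (fun=> 1))).
    congr (act (W (res_dual e chi) (fun=> 1)) _); apply: val_inj; rewrite /= uval_insubd ?aff_proj_unit ?subxx //.
    by congr Aff; apply: val_inj; rewrite /= ?idemP ?scaler0.
  rewrite g1 => id0; apply: nzAB; apply/eqP; rewrite -subv0; apply/subvP=> y _.
  by rewrite -kf memv_ker -[f y]id_lfunE id0 zero_lfunE.
- move=> m ndvd; rewrite /= /sharp_act; case: (pideal_subP e (slope m)) => // em.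
  by case: ndvd; apply/gidem_factorP.
Qed.

Section Series.
Variables (n : nat) (U : nat -> submodule X).
Hypothesis U_series : composition_series n U.

Lemma series_mono i k : (i <= k <= n)%N -> (U i <= U k)%VS.
Proof.
case: U_series => _ _ step /andP[]; elim: k => [|k IHk].
  by rewrite leqn0 => /eqP->.
rewrite leq_eqVlt => /orP[/eqP-> // | le_ik] lt_kn.
exact: subv_trans (IHk le_ik (ltnW lt_kn)) (step k lt_kn).1.
Qed.

(** The factor is the one at which [charvec chi] enters the chain. *)
Lemma exists_series_factor chi : exists j : 'I_n, factor_char (U j.+1) (U j) chi.
Proof.
case: U_series => U0 Un _.
have: charvec chi \in (U n : {vspace X}) by rewrite Un memvf.
have : (n <= n)%N by [].
elim: {1 3}n => [_|k IHk lt_kn].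
  rewrite U0 memv0 => /eqP v0; have := fourier_charvec_neq0 chi.
  by rewrite v0 linear0 eqxx.
have [Uk _|nUk Uk1] := boolP (charvec chi \in (U k : {vspace X})).
  exact: IHk (ltnW lt_kn) Uk.
by exists (Ordinal lt_kn); rewrite /factor_char Uk1.
Qed.

Lemma series_factor_uniq chi (j k : 'I_n) : factor_char (U j.+1) (U j) chi ->
  factor_char (U k.+1) (U k) chi -> j = k.
Proof.
wlog lt_jk : j k / (j < k)%N => [IH jchi kchi|].
  case: (ltngtP j k) => [lt|lt|/val_inj //]; first exact: IH.
  by apply/esym; apply: IH.
move=> /andP[j1 _] /andP[_ /negP[]]; apply: subvP j1; apply: series_mono.
by rewrite lt_jk ltnW.
Qed.

End Series.
End Apex.

(** * Matching composition factors with orbits *)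

Theorem theorem3p11 (K : realType) (R : finComPzRingType) (V : finmod R)
    (e : idem R) (s : nat) (O : 'I_s -> set (dual K[i] V))
    (chi : 'I_s -> dual K[i] V)
    (O_inj : injective O)
    (O_orbits : range O = (dorbit e @` edual K[i] V e)%classic)
    (chi_in_O : forall i, O i (chi i))
    (n : nat) (U : nat -> submodule (freemod V K[i]))
    (U_series : composition_series n U) :
  let factor (j : 'I_n) := subquot (U j.+1) (U j) in
  let Ws (i : 'I_s) := Wsharp (res_dual e (chi i)) (fun=> 1) in
  let selected (i : 'I_s) :=
    (O i `<=` edual K[i] V e `\`
       \bigcup_(f in [set f : idem R | pideal f \proper pideal e]) edual K[i] V f)%classic in
  (forall j : 'I_n, apex (gidem V e) (factor j) ->
     exists! i : 'I_s, selected i /\ iso (factor j) (Ws i)) /\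
  (forall i : 'I_s, selected i ->
     apex (gidem V e) (Ws i) /\ exists! j : 'I_n, iso (factor j) (Ws i)).
Proof.
move=> factor Ws selected; case: (U_series) => _ _ U_step.
have U_sub (j : 'I_n) : (U j <= U j.+1)%VS by case: (U_step j (ltn_ord j)).
have U_simple (j : 'I_n) : simple (factor j) by case: (U_step j (ltn_ord j)).
pose char_of (j : 'I_n) := factor_char (U j.+1) (U j).
have OE i : dact e (chi i) = chi i /\ O i = dorbit e (chi i).
  have : range O (O i) by exists i.
  rewrite O_orbits => -[theta etheta Otheta].
  have thetachi : dorbit e theta (chi i) by rewrite Otheta; apply: chi_in_O.
  by rewrite -Otheta (dorbit_eq etheta thetachi) (dorbit_edual etheta thetachi).
(* The orbit condition can be tested at [chi i], since leastness of [e] passes along the orbit. *)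
have selP i : selected i <-> min_idem e (chi i).
  have [echi Oi] := OE i; split=> [sel|min_i psi].
    have [_ nfchi] := sel _ (chi_in_O i).
    by apply/min_idemP; split=> // f ef fchi; apply: nfchi; exists f.
  rewrite Oi => /(min_idem_dorbit min_i)/min_idemP[epsi nfpsi].
  by split=> // -[f ef fpsi]; apply: nfpsi ef fpsi.
have char_iso j i : min_idem e (chi i) -> char_of j (chi i) -> iso (factor j) (Ws i).
  by move=> min_i chj; apply (factor_iso (U_sub j) (U_simple j) chj min_i).
(* Some factor [k] has weight [chi i] and so is isomorphic to [Ws i] too; isomorphic factors share
   their weights. *)
have iso_char j i : min_idem e (chi i) -> iso (factor j) (Ws i) -> char_of j (chi i).
  move=> min_i iso_j; have [k chk] := exists_series_factor U_series (chi i).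
  exact: iso_factor_char (iso_trans iso_j (iso_sym (char_iso _ _ min_i chk))) chk.
split=> [j apex_j | i /selP min_i].
  have [x Ux nUx] := simple_subquot_neq (U_simple j).
  have [psi chj _] := separating_factor_char Ux nUx.
  have min_psi := apex_min_idem (U_sub j) (U_simple j) chj apex_j.
  have [i _ Oi] : range O (dorbit e psi) by rewrite O_orbits; exists psi => //; apply: min_psi.1.
  have psi_i : dorbit e psi (chi i) by rewrite -Oi.
  have min_i := min_idem_dorbit min_psi psi_i.
  have chi_j : char_of j (chi i) by apply: dorbit_factor_char psi_i.
  exists i; split=> [|i' [/selP min_i' iso_i']]; first by split; [apply/selP | apply: char_iso].
  (* A second index gives a weight [chi i'] of the same factor, and the weights of a factor form one
     orbit. *)
  have chi_j' := iso_char _ _ min_i' iso_i'.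
  apply: O_inj; rewrite (OE i).2 (OE i').2; apply: dorbit_eq min_i.1 _.
  by apply (factor_char_dorbit (U_sub j) (U_simple j) chi_j min_i chi_j').
(* Multiplicity one: [chi i] is a weight of exactly one factor. *)
have [j chj] := exists_series_factor U_series (chi i).
have iso_j := char_iso _ _ min_i chj.
split; first exact: apex_Wsharp (U_simple j) iso_j.
exists j; split=> // k /(iso_char _ _ min_i) chk.
by apply (series_factor_uniq U_series chj chk).
Qed.
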